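(* Let $A\in\mathbb{R}^{n\times n}$ be symmetric and let $u\in\mathbb{R}^n$ be nonzero with $u^TAu\ne0$. For any $\alpha\in\mathbb{R}$ there exists an eigenvalue $\lambda$ of $A$ such that $$\frac{|\lambda-\alpha|}{\sqrt{1+\lambda^2}\,\sqrt{1+\alpha^2}}\ \le\ \frac{1}{\sqrt{1+\lambda^2}\,\|u\|}\cdot\frac{\|(A-\alpha I)u\|}{\sqrt{1+\alpha^2}},$$ where the upper bound is minimized by the choice of the homogeneous Rayleigh quotient of $A$ at $u$ for $\alpha$.
   Context: $\|\cdot\|$ is the Euclidean norm. The left-hand side is the chordal distance between $\lambda$ and $\alpha$. For $u^TAu\ne0$ the homogeneous Rayleigh quotient of $A$ at $u$ is $$\frac{1}{2\,u^TAu}\Big[u^TA^2u-u^Tu+\sqrt{(u^TA^2u-u^Tu)^2+4(u^TAu)^2}\Big];$$ equivalently, it is the ratio $\alpha_1/\alpha_2$, where $(\alpha_1,\alpha_2)$ minimizes $\frac{\|\alpha_1u-\alpha_2Au\|}{\sqrt{\alpha_1^2+\alpha_2^2}}$ over $\mathbb{R}^2\setminus\{0\}$ (modulo nonzero scalars). *)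

(* Defs.v *)
From mathcomp Require Export all_boot all_order all_algebra.
From mathcomp Require Export reals.

Set Implicit Arguments.
Unset Strict Implicit.
Unset Printing Implicit Defensive.

Import Order.TTheory GRing.Theory Num.Theory.
Local Open Scope ring_scope.

(* The norm [`|u|] that the analysis library puts on matrices is the sup norm,
   hence this separate definition of the Euclidean norm. *)
Definition enorm (R : realType) (n : nat) (u : 'cV[R]_n) : R :=
  Num.sqrt (\sum_(i < n) u i 0 ^+ 2).

Definition quad (R : realType) (n : nat) (A : 'M[R]_n) (u : 'cV[R]_n) : R :=
  (u^T *m A *m u) 0 0.

Definition chordal_dist (R : realType) (x y : R) : R :=
  `|x - y| / (Num.sqrt (1 + x ^+ 2) * Num.sqrt (1 + y ^+ 2)).

(* Meaningful only when [quad A u != 0]; division by 0 returns 0 otherwise. *)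
Definition hom_rayleigh (R : realType) (n : nat) (A : 'M[R]_n)
    (u : 'cV[R]_n) : R :=
  let d := quad (A *m A) u - (u^T *m u) 0 0 in
  (2 * quad A u)^-1 * (d + Num.sqrt (d ^+ 2 + 4 * quad A u ^+ 2)).

Definition chordal_bound (R : realType) (n : nat) (A : 'M[R]_n)
    (u : 'cV[R]_n) (lambda alpha : R) : R :=
  1 / (Num.sqrt (1 + lambda ^+ 2) * enorm u) *
  (enorm ((A - alpha%:M) *m u) / Num.sqrt (1 + alpha ^+ 2)).

(* Main.v *)
(** In a unitary eigenbasis of the real symmetric matrix [A], the squared norms
    of [u] and [(A - alpha) u] are the sums of [y i] and of
    [(d i - alpha) ^+ 2 * y i], where the [d i] are the eigenvalues and
    [y i >= 0]; the eigenvalue nearest to [alpha] gives the first claim. For the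
    second, the squared bound is, up to a factor independent of [alpha], a ratio
    of two quadratic polynomials in [alpha], and the homogeneous Rayleigh
    quotient [rho] is a root of [b rho^2 - (a - c) rho - b], where
    [a = u^T A^2 u], [b = u^T A u] and [c = u^T u]. *)
From mathcomp Require Import spectral sesquilinear complex ring.
Require Import Defs.

Import Order.TTheory GRing.Theory Num.Theory.
Local Open Scope ring_scope.

Lemma enorm_sqr (R : realType) (n : nat) (u : 'cV[R]_n) :
  enorm u ^+ 2 = \sum_i u i 0 ^+ 2.
Proof. by rewrite sqr_sqrtr // sumr_ge0 // => i _; rewrite sqr_ge0. Qed.

Lemma enorm_ge0 (R : realType) (n : nat) (u : 'cV[R]_n) : 0 <= enorm u.
Proof. exact: sqrtr_ge0. Qed.

Lemma enorm_gt0 (R : realType) (n : nat) (u : 'cV[R]_n) :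
  u != 0 -> 0 < enorm u.
Proof.
move=> u_neq0; rewrite lt_def enorm_ge0 andbT.
apply: contra u_neq0 => /eqP enorm0.
have : enorm u ^+ 2 == 0 by rewrite enorm0 expr0n.
rewrite enorm_sqr psumr_eq0 => [/allP u0|i _]; last exact: sqr_ge0.
apply/eqP/colP => i; rewrite mxE; apply/eqP; rewrite -sqrf_eq0.
exact: u0 (mem_index_enum i).
Qed.

Lemma enorm_sqrE (R : realType) (n : nat) (u : 'cV[R]_n) :
  enorm u ^+ 2 = (u^T *m u) 0 0.
Proof. by rewrite enorm_sqr mxE; apply: eq_bigr => i _; rewrite mxE expr2. Qed.

Lemma residual_sqr (R : realType) (n : nat) (A : 'M[R]_n) (u : 'cV[R]_n)
    (alpha : R) : A^T = A ->
  enorm ((A - alpha%:M) *m u) ^+ 2 =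
  quad (A *m A) u - 2 * alpha * quad A u + alpha ^+ 2 * (u^T *m u) 0 0.
Proof.
move=> A_sym; rewrite enorm_sqrE trmx_mul linearB /= A_sym tr_scalar_mx.
rewrite mulmxBr mul_mx_scalar !mulmxBl mulmxBr mul_scalar_mx.
rewrite -!scalemxAl !mulmxBr -!scalemxAr /quad !mulmxA !mxE.
ring.
Qed.

(** The right side minus the left is [(rho - alpha) ^+ 2 * s] plus a multiple of the quadratic that
    [rho] annihilates, where [s] is the square root in [rho]. Taking that root with a plus sign is
    what makes [rho] a minimizer rather than a maximizer. *)
Lemma binary_form_ratio_min (R : rcfType) (a b c alpha : R) : b != 0 ->
  let rho :=
    (2 * b)^-1 * (a - c + Num.sqrt ((a - c) ^+ 2 + 4 * b ^+ 2)) in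
  (a - 2 * rho * b + rho ^+ 2 * c) * (1 + alpha ^+ 2) <=
  (a - 2 * alpha * b + alpha ^+ 2 * c) * (1 + rho ^+ 2).
Proof.
move=> b_neq0.
have disc_ge0 : 0 <= (a - c) ^+ 2 + 4 * b ^+ 2.
  by rewrite addr_ge0 ?sqr_ge0 // mulr_ge0 ?ler0n ?sqr_ge0.
have := sqr_sqrtr disc_ge0; have := sqrtr_ge0 ((a - c) ^+ 2 + 4 * b ^+ 2).
move: (Num.sqrt _) => s s_ge0 s2E /=; set rho := _^-1 * _.
have sE : s = 2 * b * rho - (a - c) by rewrite /rho; field.
clearbody rho; subst s.
have rho_root : b * rho ^+ 2 = (a - c) * rho + b.
  (* The left side equals [s ^+ 2] minus the discriminant once [s] is written as
     [2 * b * rho - (a - c)]. *)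
  have : 4 * b * (b * rho ^+ 2 - ((a - c) * rho + b)) = 0.
    by move/eqP: s2E; rewrite -subr_eq0 => /eqP <-; ring.
  move/eqP; rewrite !mulf_eq0 pnatr_eq0 (negPf b_neq0) /= subr_eq0.
  by move/eqP.
rewrite -subr_ge0.
have -> : (a - 2 * alpha * b + alpha ^+ 2 * c) * (1 + rho ^+ 2) -
    (a - 2 * rho * b + rho ^+ 2 * c) * (1 + alpha ^+ 2) =
    (rho - alpha) ^+ 2 * (2 * b * rho - (a - c)) +
    2 * (rho - alpha) * ((a - c) * rho + b - b * rho ^+ 2) by ring.
by rewrite rho_root subrr mulr0 addr0 mulr_ge0 ?sqr_ge0.
Qed.

Lemma hom_rayleigh_min (R : realType) (n : nat) (A : 'M[R]_n) (u : 'cV[R]_n)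
    (alpha : R) : A^T = A -> quad A u != 0 ->
  enorm ((A - (hom_rayleigh A u)%:M) *m u) ^+ 2 * (1 + alpha ^+ 2) <=
  enorm ((A - alpha%:M) *m u) ^+ 2 * (1 + hom_rayleigh A u ^+ 2).
Proof.
by move=> A_sym b_neq0; rewrite !residual_sqr //; exact: binary_form_ratio_min.
Qed.

Lemma dotmx_mul_unitary (C : numClosedFieldType) (n : nat) (P : 'M[C]_n)
    (x : 'rV[C]_n) : P \is unitarymx -> dotmx (x *m P) (x *m P) = dotmx x x.
Proof.
move=> P_unitary; rewrite !dotmxE trmx_mul map_mxM mulmxA.
by rewrite mulmxtVK.
Qed.

Lemma dotmx_self (C : numClosedFieldType) (n : nat) (x : 'rV[C]_n) :
  dotmx x x = \sum_i `|x 0 i| ^+ 2.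
Proof. by rewrite dotmxE mxE; apply: eq_bigr => i _; rewrite !mxE normCK. Qed.

(** Carries real norms over to the Hermitian form on complex row vectors, in which the spectral
    decomposition is stated. *)
Lemma dotmx_real_complex (R : realType) (n : nat) (u : 'cV[R]_n) :
  let w := map_mx (real_complex R) u^T in
  dotmx w w = (enorm u ^+ 2)%:C%C.
Proof.
rewrite /= dotmx_self enorm_sqr rmorph_sum; apply: eq_bigr => i _ /=.
by rewrite !mxE real_normK ?rmorphXn // complex_real.
Qed.

(** From [B = P^-1 D P] follows [P B = D P], so the rows of [P] are left eigenvectors; they are
    nonzero because [P] is invertible. *)
Lemma eigenvalue_spectral_diag (C : numClosedFieldType) (n : nat)
    (B : 'M[C]_n) (i : 'I_n) :
  B \is normalmx -> eigenvalue B (spectral_diag B 0 i).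
Proof.
move=> /orthomx_spectralP B_eq; apply/eigenvalueP.
have P_unit := spectral_unit B.
exists (row i (spectralmx B)).
  rewrite -row_mul {2}B_eq !mulmxA mulmxV // mul1mx row_mul row_diag_mx.
  by rewrite -scalemxAl -rowE.
apply: contraTneq (oner_neq0 C) => row0; apply/negPn/eqP.
have : (row i (spectralmx B) *m invmx (spectralmx B)) 0 i = 0.
  by rewrite row0 mul0mx mxE.
by rewrite -row_mul mulmxV // !mxE eqxx.
Qed.

Lemma symmetric_spectral_sums (R : realType) (n : nat) (A : 'M[R]_n)
    (u : 'cV[R]_n) : A^T = A ->
  exists d y : 'I_n -> R,
    [/\ forall i, eigenvalue A (d i), forall i, 0 <= y i,
        enorm u ^+ 2 = \sum_i y i &
        forall alpha, enorm ((A - alpha%:M) *m u) ^+ 2 =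
          \sum_i (d i - alpha) ^+ 2 * y i].
Proof.
move=> A_sym; pose B := map_mx (real_complex R) A.
have B_sym : B \is symmetricmx.
  by apply/is_hermitianmxP; rewrite expr0 scale1r map_mx_id // map_trmx A_sym.
have B_real : B \is a mxOver Num.real.
  by apply/mxOverP => i j; rewrite mxE complex_real.
have B_herm := realsym_hermsym B_sym B_real.
have B_normal := hermitian_normalmx B_herm.
have /mxOverP D_real := hermitian_spectral_diag_real B_herm.
have P_unitary := spectral_unitarymx B.
set P := spectralmx B in P_unitary.
(* The coordinates of [u^T] in the eigenbasis formed by the rows of [P]; their squared moduli serve
   as the weights [y]. *)
pose x := map_mx (real_complex R) u^T *m invmx P.
have xP : x *m P = map_mx (real_complex R) u^T.
  by rewrite mulmxKV // spectral_unit.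
pose d i := @complex.Re R (spectral_diag B 0 i).
have dE i : (d i)%:C%C = spectral_diag B 0 i by rewrite (@RRe_real R).
exists d, (fun i => @complex.Re R (`|x 0 i| ^+ 2)).
have yE i : (@complex.Re R (`|x 0 i| ^+ 2))%:C%C = `|x 0 i| ^+ 2.
  by rewrite (@RRe_real R) // ger0_real // exprn_ge0.
split=> [i|i||alpha].
- by rewrite -(eigenvalue_map (real_complex R)) /= dE eigenvalue_spectral_diag.
- by rewrite -ler0c yE exprn_ge0.
- apply: complexI; rewrite -dotmx_real_complex -xP dotmx_mul_unitary //.
  by rewrite dotmx_self rmorph_sum; apply: eq_bigr => i _ /=; rewrite yE.
- apply: complexI; rewrite -dotmx_real_complex trmx_mul linearB /= A_sym.
  rewrite tr_scalar_mx map_mxM map_mxB map_scalar_mx /= -xP -/B.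
  (* Moving [P] to the far right turns [B] into its diagonal form, and a unitary factor on the right
     does not change the norm. *)
  have -> : x *m P *m (B - (alpha%:C%C)%:M) =
      x *m (diag_mx (spectral_diag B) - (alpha%:C%C)%:M) *m P.
    rewrite mulmxBr mulmxBr mulmxBl !mul_mx_scalar -scalemxAl; congr (_ - _).
    move/orthomx_spectralP: B_normal => {1}->.
    by rewrite !mulmxA mulmxK // spectral_unit.
  rewrite dotmx_mul_unitary // dotmx_self rmorph_sum.
  apply: eq_bigr => i _; rewrite rmorphM /= yE rmorphXn /= rmorphB /= dE.
  rewrite mulmxBr mul_mx_diag mul_mx_scalar !mxE.
  rewrite [alpha%:C%C * _]mulrC -mulrBr normrM exprMn mulrC.
  by rewrite real_normK // rpredB ?D_real // complex_real.
Qed.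

Lemma eigenvalue_residual (R : realType) (n : nat) (A : 'M[R]_n)
    (u : 'cV[R]_n) (alpha : R) : A^T = A -> u != 0 ->
  exists2 lambda : R, eigenvalue A lambda &
    `|lambda - alpha| * enorm u <= enorm ((A - alpha%:M) *m u).
Proof.
move=> A_sym /enorm_gt0 u_gt0.
have [d [y [d_eig y_ge0 uE rE]]] := symmetric_spectral_sums _ _ _ u A_sym.
(* Minimizing over indices needs one to exist: for [n = 0] the norm of [u] would be an empty sum,
   hence zero. *)
have i0 : 'I_n.
  case: n A u A_sym u_gt0 d y d_eig y_ge0 uE rE => [|m] A0 u0 _ u0_gt0 d y _ _.
    by move/eqP; rewrite big_ord0 sqrf_eq0 gt_eqF.
  by move=> *; exact: ord0.
case: (@Order.TotalTheory.arg_minP _ _ _ i0 predT (fun i => `|d i - alpha|)) => //.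
move=> i _ i_min; exists (d i) => //.
rewrite -ler_sqr ?nnegrE ?mulr_ge0 ?enorm_ge0 //.
(* With equal weights [y j] on both sides, the sums compare term by term by the choice of [i]. *)
rewrite exprMn uE rE mulr_sumr; apply: ler_sum => j _.
by rewrite ler_wpM2r // -[leRHS]real_normK ?num_real // ler_sqr ?nnegrE ?i_min.
Qed.

Theorem mainTheorem4 (R : realType) (n : nat) (A : 'M[R]_n) (u : 'cV[R]_n)
    (A_sym : A^T = A) (u_neq0 : u != 0) (uAu_neq0 : quad A u != 0) :
  (forall alpha : R, exists lambda : R,
     eigenvalue A lambda /\
     chordal_dist lambda alpha <= chordal_bound A u lambda alpha) /\
  (forall lambda : R, eigenvalue A lambda ->
     forall alpha : R,
       chordal_bound A u lambda (hom_rayleigh A u)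
       <= chordal_bound A u lambda alpha).
Proof.
have sqrt_gt0 (x : R) : 0 < Num.sqrt (1 + x ^+ 2).
  by rewrite sqrtr_gt0 ltr_pwDl ?sqr_ge0.
have u_gt0 := enorm_gt0 _ _ _ u_neq0.
split=> [alpha|lambda _ alpha].
  have [lambda lambda_eig res_ge] := eigenvalue_residual _ _ _ _ alpha A_sym u_neq0.
  exists lambda; split=> //; rewrite /chordal_dist /chordal_bound.
  rewrite ler_pdivrMr ?mulr_gt0 //.
  (* Both chordal square roots cancel, leaving the classical residual bound on
     [|lambda - alpha|]. *)
  have -> (l e a r : R) : 0 < l -> 0 < e -> 0 < a ->
      1 / (l * e) * (r / a) * (l * a) = r / e.
    by move=> l_gt0 e_gt0 a_gt0; field; rewrite !gt_eqF.
  - by rewrite ler_pdivlMr.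
  - exact: sqrt_gt0.
  - exact: u_gt0.
  - exact: sqrt_gt0.
(* The first factor of the bound does not involve [alpha]; cross-multiplying and squaring the rest
   removes all square roots outside the Rayleigh quotient. *)
rewrite /chordal_bound ler_wpM2l ?divr_ge0 ?mulr_ge0 ?enorm_ge0 ?sqrtr_ge0 //.
rewrite ler_pdivrMr // mulrAC ler_pdivlMr //.
rewrite -ler_sqr ?nnegrE ?mulr_ge0 ?enorm_ge0 ?sqrtr_ge0 //.
have sqrt_sqr (x : R) : Num.sqrt (1 + x ^+ 2) ^+ 2 = 1 + x ^+ 2.
  by rewrite sqr_sqrtr // addr_ge0 ?sqr_ge0.
rewrite [leLHS]exprMn [leRHS]exprMn !sqrt_sqr.
exact: hom_rayleigh_min.
Qed.
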